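(* Let $l \geq 1$ and $m \geq 1$ be integers, let $X_0, X_1, \ldots, X_{l+1}$ be Banach spaces, let $\Omega_i \subseteq X_i$ be open sets for $0 \leq i \leq l+1$, and let $f_i : \Omega_i \to \Omega_{i+1}$ be mappings for $0 \le i \le l$. Let $x \in \Omega_0$, set $x_0 := x$ and $x_{i+1} := f_i(x_i)$, and assume that $f_i$ is $m$-times Fréchet differentiable at $x_i$ for each $0 \leq i \leq l$. Then for all $v_1,\ldots,v_m \in X_0$, $$\nabla^{m}\left(f_l \circ \cdots \circ f_1 \circ f_0\right)_{|x}(v_1, v_2, \ldots, v_m) = \sum_{\mathcal{P} \in \mathcal{P}^{l}(m)} \nabla_{\mathcal{P}} f_{l|x_l}.$$
   Context: $\nabla^k g_{|x}$ denotes the $k$-th Fréchet derivative of $g$ at $x$, a bounded symmetric $k$-linear map. Nested partitions: for a finite set $A$, $\mathcal{P}(A) = \mathcal{P}^1(A)$ is the set of all partitions of $A$ into non-empty pairwise disjoint sets. Recursively, $\mathcal{P}^{l+1}(A)$ is the set of all partitions of members of $\mathcal{P}^{l}(A)$, i.e. $\mathcal{P}^{l+1}(A) = \bigcup_{\mathcal{C} \in \mathcal{P}^{l}(A)} \mathcal{P}(\mathcal{C})$; equivalently, $\mathcal{P}^{l+1}(A)$ consists of all sets $\{D_1,\ldots,D_k\}$ such that $D_i \in \mathcal{P}^{l}(P_i)$ for $1 \le i \le k$ for some partition $\{P_1,\ldots,P_k\} \in \mathcal{P}(A)$. We write $\mathcal{P}^l(m) := \mathcal{P}^l(\{1,\ldots,m\})$.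 Notation $\nabla_{\mathcal{P}}$ (depending on the fixed vectors $v_1,\ldots,v_m$): for $A \subseteq \{1,\ldots,m\}$ non-empty, $\nabla_A f_{0|x_0} := \nabla^{|A|} f_{0|x_0}(\bigvee_{i\in A} v_i)$, the value of the symmetric $|A|$-linear map on the vectors $v_i$, $i \in A$. For $j \geq 0$ and $\mathcal{P} \in \mathcal{P}^{j+1}(A)$, recursively $\nabla_{\mathcal{P}} f_{j+1|x_{j+1}} := \nabla^{|\mathcal{P}|} f_{j+1|x_{j+1}}\big(\bigvee_{P \in \mathcal{P}} \nabla_{P} f_{j|x_j}\big)$, i.e. the value of the symmetric $|\mathcal{P}|$-linear map $\nabla^{|\mathcal{P}|} f_{j+1|x_{j+1}}$ on the vectors $\nabla_P f_{j|x_j} \in X_{j+1}$, $P \in \mathcal{P}$ (where $P\in\mathcal{P}^{j}(A')$ for some $A'\subseteq A$ if $j\ge1$, and $P \subseteq A$ if $j=0$). *)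

(* Defs.v *)
From HB Require Import structures.
From mathcomp Require Import all_boot all_order all_algebra.
From mathcomp Require Import all_classical all_reals all_analysis.
From mathcomp Require Import complex.

Set Implicit Arguments.
Unset Strict Implicit.
Unset Printing Implicit Defensive.

Import Order.TTheory GRing.Theory Num.Theory.
Import numFieldNormedType.Exports.

Local Open Scope classical_set_scope.
Local Open Scope ring_scope.

Inductive scalars := RealScalars | ComplexScalars.

Definition scalar_field (R : realType) (s : scalars) : numFieldType :=
  match s with RealScalars => R | ComplexScalars => R[i] end.

Lemma scalar_inf_exists (R : realType) (s : scalars)
    (A : set (scalar_field R s)) :
  A !=set0 -> (forall a, A a -> 0 <= a) ->
  exists2 m, lbound A m & forall m', lbound A m' -> m' <= m.
Proof.
case: s A => /= A [a0 Aa0] A0.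
  exists (inf A); first by move=> a Aa; apply: ge_inf => //; exists 0.
  by move=> m' Am'; apply: lb_le_inf => //; exists a0.
have Areal a : A a -> a = (complex.Re a)%:C%C.
  by move=> /A0/ger0_real/complex.RRe_real.
have Re_ge0 r : [set complex.Re a | a in A] r -> 0 <= r.
  by move=> [a Aa <-]; have := A0 _ Aa; rewrite {1}(Areal _ Aa) ler0c.
exists (inf [set complex.Re a | a in A])%:C%C.
  move=> a Aa; rewrite (Areal _ Aa) lecR.
  by apply: ge_inf; [exists 0 | exists a].
move=> m' Am'.
have m'real : m' = (complex.Re m')%:C%C.
  rewrite complex.RRe_real//.
  have := Am' _ Aa0; rewrite -subr_ge0 => /ger0_real h.
  have a0real : a0 \is Num.real by exact/ger0_real/A0.
  by rewrite -[m'](subKr a0) rpredB.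
rewrite m'real lecR; apply: lb_le_inf; first by exists (complex.Re a0), a0.
move=> _ [a Aa <-]; have := Am' _ Aa.
by rewrite m'real (Areal _ Aa) lecR.
Qed.

Section BoundedLinear.
Context {K : numFieldType} (X Y : normedModType K).

Definition blinear_pred : {pred X -> Y} :=
  fun u => `[< linear u /\ continuous u >].

Record blin := Blin { blin_fun :> X -> Y; blinP : blin_fun \in blinear_pred }.

HB.instance Definition _ := [isSub for blin_fun].
HB.instance Definition _ := [Choice of blin by <:].

Lemma blinear_pred_submod_closed : submod_closed blinear_pred.
Proof.
split.
  rewrite inE; split; first by move=> a x y; rewrite scaler0 addr0.
  by move=> x; exact: cvg_cst.
move=> a u w; rewrite !inE => -[lu cu] [lw cw]; split.
  move=> b x y; rewrite !fctE /= lu lw !scalerDr !scalerA (mulrC a b).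
  by rewrite addrACA.
by move=> x; apply: cvgD; [apply: cvgZl_tmp; exact: cu | exact: cw].
Qed.

HB.instance Definition _ :=
  GRing.isSubmodClosed.Build K (X -> Y) blinear_pred blinear_pred_submod_closed.
HB.instance Definition _ := [SubChoice_isSubLmodule of blin by <:].

Lemma blin_linear (u : blin) : linear u.
Proof. by case: u => u /=; rewrite inE => -[]. Qed.

Lemma blin_continuous (u : blin) : continuous u.
Proof. by case: u => u /=; rewrite inE => -[]. Qed.

Definition blin_bounds (u : blin) : set K :=
  [set C | 0 <= C /\ forall x, `|u x| <= C * `|x|].

Lemma blin_bounds_neq0 (u : blin) : blin_bounds u !=set0.
Proof.
pose ul := GRing.isLinear.Build K X Y *:%R u (blin_linear u).
pose uL : {linear X -> Y} := HB.pack (blin_fun u) ul.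
have /continuous_linear_bounded : {for 0, continuous uL} by exact: blin_continuous.
move=> h; have [M M0 uM] := pinfty_ex_gt0 ((linear_boundedP uL).1 (h 0)).
by exists M; split => //; exact: ltW.
Qed.

End BoundedLinear.

Section OperatorNorm.
Context {R : realType} {s : scalars}.
Local Notation K := (scalar_field R s).
Variables X Y : normedModType K.
Implicit Types u w : blin X Y.

(* The operator norm: the least C >= 0 such that |u x| <= C |x| for all x.  It
   is K-valued because norms of a normedModType K take values in K. *)
Definition opnorm u : K := get [set C | blin_bounds u C /\ lbound (blin_bounds u) C].

Lemma opnormP u : blin_bounds u (opnorm u) /\ lbound (blin_bounds u) (opnorm u).
Proof.
rewrite /opnorm; apply: (@getPex _ [set C | blin_bounds u C /\ lbound (blin_bounds u) C]).
have bounds_ge0 C : blin_bounds u C -> 0 <= C by case.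
have [m mlb mglb] := scalar_inf_exists (blin_bounds_neq0 u) bounds_ge0.
exists m; split => //; split; first by apply: mglb => a [].
move=> x; have [->|x0] := eqVneq x 0.
  rewrite normr0 mulr0.
  by have [C [_ /(_ 0)]] := blin_bounds_neq0 u; rewrite normr0 mulr0.
rewrite -ler_pdivrMr ?normr_gt0//; apply: mglb => C [_ uC].
by rewrite ler_pdivrMr ?normr_gt0.
Qed.

Lemma opnorm_ge0 u : 0 <= opnorm u.
Proof. by have [[]] := opnormP u. Qed.

Lemma le_opnorm u x : `|u x| <= opnorm u * `|x|.
Proof. by have [[]] := opnormP u. Qed.

Lemma opnorm_le u C : 0 <= C -> (forall x, `|u x| <= C * `|x|) -> opnorm u <= C.
Proof. by move=> C0 uC; have [_] := opnormP u; apply. Qed.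

Lemma opnormD u w : opnorm (u + w) <= opnorm u + opnorm w.
Proof.
apply: opnorm_le; first by rewrite addr_ge0 ?opnorm_ge0.
by move=> x; rewrite mulrDl (le_trans (ler_normD _ _))// lerD ?le_opnorm.
Qed.

Lemma opnormZ_le (a : K) u : opnorm (a *: u) <= `|a| * opnorm u.
Proof.
apply: opnorm_le; first by rewrite mulr_ge0 ?opnorm_ge0.
by move=> x; rewrite [X in `|X|]/(a *: u x) normrZ -mulrA ler_wpM2l ?le_opnorm.
Qed.

Lemma opnormZ (a : K) u : opnorm (a *: u) = `|a| * opnorm u.
Proof.
apply/eqP; rewrite eq_le opnormZ_le /=.
have [->|a0] := eqVneq a 0; first by rewrite normr0 mul0r opnorm_ge0.
rewrite -ler_pdivlMl ?normr_gt0// -normfV.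
by rewrite -{1}[u](scalerK a0) opnormZ_le.
Qed.

Lemma opnorm_eq0 u : opnorm u = 0 -> u = 0.
Proof.
move=> u0; apply/val_inj/funext => x /=.
by have := le_opnorm u x; rewrite u0 mul0r normr_le0 => /eqP.
Qed.

HB.instance Definition _ :=
  Lmodule_isNormed.Build K (blin X Y) opnormD opnormZ opnorm_eq0.

End OperatorNorm.

Section FrechetDerivatives.
Context {R : realType} {s : scalars}.
Local Notation K := (scalar_field R s).

(* Bounded k-linear maps X^k -> Y, as L(X, L(X, ... L(X, Y))). *)
Fixpoint mlin (k : nat) (X Y : normedModType K) : normedModType K :=
  match k with 0 => Y | k'.+1 => blin X (mlin k' X Y) end.

Fixpoint mlin_app (k : nat) (X Y : normedModType K) :
    mlin k X Y -> ('I_k -> X) -> Y :=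
  match k return mlin k X Y -> ('I_k -> X) -> Y with
  | 0 => fun u _ => u
  | k'.+1 => fun u v => mlin_app (u (v ord0)) (fun i => v (lift ord0 i))
  end.

(* [insubd 0] bundles the differential with its continuity; it returns the junk
   value 0 only where the function is not differentiable. *)
Fixpoint nabla (k : nat) (X Y : normedModType K) (g : X -> Y) : X -> mlin k X Y :=
  match k return X -> mlin k X Y with
  | 0 => g
  | k'.+1 => fun x => insubd (0 : blin X (mlin k' X Y)) ('d (nabla k' g) x : X -> _)
  end.

Fixpoint differentiable_n (k : nat) (X Y : normedModType K) (g : X -> Y) (x : X) : Prop :=
  match k with
  | 0 => True
  | k'.+1 => (\forall y \near x, differentiable_n k' g y) /\
             differentiable (nabla k' g) x
  end.

End FrechetDerivatives.

Section NestedPartitions.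
Variable T : finType.

(* Sets of sets of ... of elements of T, with n levels of nesting. *)
Fixpoint nested_set (n : nat) : finType :=
  match n with 0 => T | n'.+1 => {set nested_set n'} end.

(* The recursion starts one step earlier, at {A}, so that
   [nested_partitions A 1] is the set of all partitions of A. *)
Fixpoint nested_partitions (A : {set T}) (l : nat) : {set nested_set l.+1} :=
  match l return {set nested_set l.+1} with
  | 0 => [set A]%SET
  | l'.+1 => (\bigcup_(C in nested_partitions A l') [set P | finset.partition P C])%SET
  end.

End NestedPartitions.

Section Chain.
Context {R : realType} {s : scalars}.
Variables (X : nat -> normedModType (scalar_field R s)) (f : forall i, X i -> X i.+1).

(* [chain n] is f_(n-1) o ... o f_0, so [chain i x] is the point x_i. *)
Fixpoint chain (n : nat) : X 0 -> X n :=
  match n return X 0 -> X n with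
  | 0 => id
  | n'.+1 => @f n' \o chain n'
  end.

(* For P with j.+1 levels of nesting, [nabla_nested x v j.+1 P] is
   nabla_P f_j at x_j; with 0 levels of nesting it is the vector v i itself, so
   that the case P \subseteq {1..m} needs no separate clause.  The arguments are
   listed in the order of [enum P], which is immaterial by symmetry. *)
Fixpoint nabla_nested (T : finType) (x : X 0) (v : T -> X 0) (j : nat) :
    nested_set T j -> X j :=
  match j return nested_set T j -> X j with
  | 0 => v
  | j'.+1 => fun P : {set nested_set T j'} =>
      mlin_app (nabla #|P| (@f j') (chain j' x))
        (fun k : 'I_#|P| => nabla_nested x v (enum_val k))
  end.

End Chain.

(* Main.v *)
Require Import Defs.
From HB Require Import structures.
From mathcomp Require Import all_boot all_order all_algebra.
From mathcomp Require Import all_classical all_reals all_analysis.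
From mathcomp Require Import ring.

(** Faa di Bruno's formula for two maps says that the m-th derivative of g o f
    in directions indexed by a finite set C is the sum, over the partitions D
    of C, of the derivative of order #|D| of g in the directions given by the
    derivatives of f along the blocks of D ([faa_di_bruno]).  The formula for a
    chain follows from it without any regrouping of nested partitions, because
    it can be unfolded from the inside: f_l o ... o f_0 is g o f_0 with
    g = f_l o ... o f_1, so its derivative is a sum over the partitions C of
    {1..m}, and each term is a derivative of f_l o ... o f_1 in the directions
    nabla_P f_0, P in C, to which the two-map formula applies again, summing
    over the partitions of the finite set C.  This is exactly the recursion
    P^(l+1)(A) = union of the P(C), C in P^l(A), and the union is disjoint since
    a partition determines the set it covers ([nabla_chain]).

    The two-map formula is proved by induction on the number of directions.  It
    holds near x for the directions already treated; differentiating it along a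
    new direction a, the chain and product rules ([dblin_mlin_map]) turn the
    term of a partition D into the terms of the partitions obtained from D by
    adding the block {a} or by adding a to one of the blocks, and these are all
    the partitions of the larger set, each obtained once ([sum_partitionU1]).

    Three analytic facts support the induction.  Higher derivatives taken at a
    point are symmetric ([nabla_sym]), so that the terms depend only on the
    sets of blocks and not on their enumerations; this is Schwarz's theorem for
    maps that are twice differentiable at one point only, which rests on a mean
    value inequality valid over the real and the complex scalars alike.  The
    composite of two maps that are k times differentiable is so
    ([differentiable_n_comp]); the proof differentiates first, using
    D(g o f) = (Dg o f) Df, and hence needs the k-th derivative of Dg to be the
    (k+1)-st derivative of g ([nabla_peel]).  Finally bounded bilinear maps
    satisfy the product rule ([is_diff_bilinear]). *)

Set Implicit Arguments.
Unset Strict Implicit.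
Unset Printing Implicit Defensive.

Import Order.TTheory GRing.Theory Num.Theory.
Import numFieldNormedType.Exports.

(** * Partitions of a finite set with one more point *)

Section PartitionsOfInsertion.
Local Open Scope set_scope.
Variables (T : finType) (a : T) (C : {set T}).
Hypothesis aC : a \notin C.
Implicit Types (B Q : {set T}) (D : {set {set T}}).

Lemma notin_block B D : finset.partition D C -> a \in B -> B \notin D.
Proof.
by move=> pD aB; apply: contra aC => /(partitionS pD)/fintype.subsetP; apply.
Qed.

Lemma partition_add_singleton D :
  finset.partition D C -> finset.partition ([set a] |: D) (a |: C).
Proof.
move=> pD; apply: partitionU1 => //; last by rewrite disjoints1.
by apply/set0Pn; exists a; rewrite inE.
Qed.

Lemma setDU1l B : a \in B -> (a |: C) :\: B = C :\: B.
Proof.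
move=> aB; apply/finset.setP => z; rewrite !inE.
by case: eqP => [->|//]; rewrite aB.
Qed.

Lemma partition_add_in_block Q D : finset.partition D C -> Q \in D ->
  finset.partition ((a |: Q) |: D :\ Q) (a |: C).
Proof.
move=> pD QD; have QC := partitionS pD QD.
have -> : a |: C = (a |: Q) :|: (C :\: Q).
  rewrite -finset.setUA finset.setDE finset.setUIr finset.setUCr finset.setIT.
  by rewrite (finset.setUidPr QC).
apply: partitionU1; first exact: partitionD1.
  by apply/set0Pn; exists a; rewrite setU11.
rewrite finset.disjoints_subset; apply/fintype.subsetP => z; rewrite !inE.
by case/predU1P => [->|->//]; rewrite (negPf aC) andbF.
Qed.

(** The inverse operation: deleting [a] from its block, when that block is not
    reduced to [a], gives a partition of [C]. *)
Section Block.
Variable D : {set {set T}}.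
Hypotheses (pD : finset.partition D (a |: C)) (aD : [set a] \notin D).
Let B := finset.pblock D a.

Lemma insert_mem_block : a \in B.
Proof. by rewrite mem_pblock (cover_partition pD) setU11. Qed.

Lemma insert_block_mem : B \in D.
Proof. by rewrite pblock_mem// (cover_partition pD) setU11. Qed.

Lemma insert_block_neq0 : B :\ a != finset.set0.
Proof.
apply: contraNneq aD => B0.
by rewrite -[[set a]]finset.setU0 -B0 finset.setD1K ?insert_mem_block
  ?insert_block_mem.
Qed.

Lemma remove_from_block : finset.partition ((B :\ a) |: D :\ B) C.
Proof.
have aB := insert_mem_block.
have BS : B :\ a \subset C.
  by rewrite finset.subDset (partitionS pD insert_block_mem).
have -> : C = (B :\ a) :|: (C :\: B).
  apply/finset.setP => z; rewrite !inE.
  have [->|za] := eqVneq z a; first by rewrite aB (negPf aC).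
  case zB: (z \in B) => //=.
  by move/fintype.subsetP: BS => /(_ z); rewrite !inE za zB => ->.
apply: partitionU1; [|exact: insert_block_neq0|].
  by rewrite -setDU1l//; apply: partitionD1 pD insert_block_mem.
rewrite finset.disjoints_subset; apply/fintype.subsetP => z.
by rewrite !inE => /andP[_ ->].
Qed.

(** This makes the deletion injective: the shortened block can be located in
    the resulting partition. *)
Lemma removed_block_notin : B :\ a \notin D :\ B.
Proof.
rewrite !inE; apply/negP => /andP[_ BaD].
have [z zBa] := finset.set0Pn _ insert_block_neq0.
have zB : z \in B by move: zBa; rewrite !inE => /andP[].
have tD := partition_trivIset pD.
have := insert_mem_block.
rewrite -(def_pblock tD insert_block_mem zB) (def_pblock tD BaD zBa).
by rewrite !inE eqxx.
Qed.
End Block.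

Variables (V : nmodType) (F : {set {set T}} -> V).

Lemma sum_partitionU1_singleton :
  (\sum_(D | finset.partition D (a |: C) && ([set a] \in D)) F D =
   \sum_(D | finset.partition D C) F ([set a] |: D))%R.
Proof.
rewrite (reindex_onto (fun D => [set a] |: D) (fun D => D :\ [set a])) /=; last first.
  by move=> D /andP[_ aD]; rewrite finset.setD1K.
apply: eq_bigl => D; apply/idP/idP => [/andP[/andP[pD _] /eqP DE]|pD].
  by rewrite -DE -(finset.setU1K aC); apply: partitionD1 pD _; rewrite setU11.
rewrite partition_add_singleton// setU11 finset.setU1K ?eqxx//.
by rewrite (notin_block pD)// inE.
Qed.

Lemma sum_partitionU1_block :
  (\sum_(D | finset.partition D (a |: C) && ([set a] \notin D)) F D =
   \sum_(D | finset.partition D C) \sum_(Q in D) F ((a |: Q) |: D :\ Q))%R.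
Proof.
rewrite pair_big_dep /=.
rewrite (reindex_onto (fun p : {set {set T}} * {set T} => (a |: p.2) |: p.1 :\ p.2)
  (fun D => ((finset.pblock D a :\ a) |: D :\ finset.pblock D a,
             finset.pblock D a :\ a))) /=; last first.
  move=> D /andP[pD aD].
  by rewrite finset.setD1K ?insert_mem_block// finset.setU1K ?removed_block_notin//
    finset.setD1K// insert_block_mem.
apply: eq_bigl => -[D Q] /=; apply/idP/idP.
  move: (_ |: _) => D' /andP[/andP[pD' aD'] /eqP[<- <-]].
  by rewrite remove_from_block// setU11.
move=> /andP[pD QD]; have pD' := partition_add_in_block pD QD.
have blockE : finset.pblock ((a |: Q) |: D :\ Q) a = a |: Q.
  by apply: def_pblock; rewrite ?setU11// (partition_trivIset pD').
have aQ : a \notin Q by apply: contraL QD; apply: notin_block.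
rewrite pD' blockE finset.setU1K// finset.setU1K; last first.
  by rewrite !inE negb_and (notin_block pD) ?setU11// orbT.
rewrite finset.setD1K// eqxx andbT.
rewrite !inE negb_or negb_and (notin_block pD) ?inE// orbT andbT.
apply: contraNneq aQ => aE.
have [z zQ] := finset.set0Pn _ (partition_neq0 pD QD).
by have : z \in [set a]; [rewrite aE !inE zQ orbT|rewrite inE => /eqP <-].
Qed.

(** Every partition of [a |: C] arises exactly once from a partition of [C], by
    adding the block [[set a]] or by adding [a] to an existing block. *)
Lemma sum_partitionU1 :
  (\sum_(D | finset.partition D (a |: C)) F D =
   \sum_(D | finset.partition D C)
     (F ([set a] |: D) + \sum_(Q in D) F ((a |: Q) |: D :\ Q)))%R.
Proof.
rewrite (bigID (fun D => [set a] \in D)) /= big_split /=.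
by rewrite sum_partitionU1_singleton sum_partitionU1_block.
Qed.
End PartitionsOfInsertion.

Local Open Scope classical_set_scope.
Local Open Scope ring_scope.

(** * Bounded operators and bilinear maps *)

Section BlinLinear.
Context {K : numFieldType} {X Y : normedModType K}.
HB.instance Definition _ (u : blin X Y) :=
  GRing.isLinear.Build K X Y *:%R (blin_fun u) (blin_linear u).
End BlinLinear.

Section BoundedOperators.
Context {R : realType} {s : scalars}.
Local Notation K := (scalar_field R s).
Implicit Types X Y Z U V W : normedModType K.

Lemma bounded_blinear X Y (f : X -> Y) (C : K) :
  linear f -> 0 <= C -> (forall x, `|f x| <= C * `|x|) ->
  f \in @blinear_pred _ X Y.
Proof.
move=> lf C0 fC; rewrite inE; split => //.
pose fl := GRing.isLinear.Build K X Y *:%R f lf.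
pose fL : {linear X -> Y} := HB.pack f fl.
apply: (@bounded_linear_continuous _ _ _ fL).
apply/linear_boundedP; exists C; split; first exact: ger0_real.
by move=> M /ltW CM x; rewrite (le_trans (fC x))// ler_wpM2r.
Qed.

Definition mkblin X Y (f : X -> Y) (C : K) (lf : linear f) (C0 : 0 <= C)
  (fC : forall x, `|f x| <= C * `|x|) : blin X Y :=
  Blin (bounded_blinear lf C0 fC).

Lemma blin_scale X Y (u : blin X Y) (a : K) x : u (a *: x) = a *: u x.
Proof. exact: linearZZ. Qed.

Lemma blinZE X Y (a : K) (u : blin X Y) x : (a *: u) x = a *: u x.
Proof. by []. Qed.

Lemma blinBE X Y (u w : blin X Y) x : (u - w) x = u x - w x.
Proof. by []. Qed.

Lemma norm_blin X Y (u : blin X Y) x : `|u x| <= `|u| * `|x|.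
Proof. exact: le_opnorm. Qed.

Lemma norm_blin_le X Y (u : blin X Y) (C : K) :
  0 <= C -> (forall x, `|u x| <= C * `|x|) -> `|u| <= C.
Proof. exact: opnorm_le. Qed.

(** Bounded bilinear maps are handled in curried form, as elements of
    [blin U (blin V W)]: this type is again a space of bounded operators, so
    bilinear maps can be composed and flipped into new bilinear maps. *)
Section Bilinear.
Variables (U V W : normedModType K) (B : U -> V -> W) (C : K).
Hypotheses (linl : forall v, linear (B^~ v)) (linr : forall u, linear (B u)).
Hypotheses (C0 : 0 <= C) (BC : forall u v, `|B u v| <= C * `|u| * `|v|).

Let partial u : blin V W :=
  mkblin (linr u) (mulr_ge0 C0 (normr_ge0 u)) (BC u).

Lemma partial_linear : linear partial.
Proof. by move=> a u w; apply/val_inj/funext => v; exact: linl. Qed.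

Lemma partial_bound u : `|partial u| <= C * `|u|.
Proof. by apply: norm_blin_le; [rewrite mulr_ge0|exact: BC]. Qed.

Definition mkblin2 : blin U (blin V W) := mkblin partial_linear C0 partial_bound.
End Bilinear.

Lemma norm_blin2 U V W (B : blin U (blin V W)) u v :
  `|B u v| <= `|B| * `|u| * `|v|.
Proof. by rewrite (le_trans (norm_blin _ _))// ler_wpM2r// norm_blin. Qed.

Section Flip.
Variables (U V W : normedModType K) (B : blin U (blin V W)).
Lemma flip_linl u : linear (B u). Proof. exact: blin_linear. Qed.
Lemma flip_linr v : linear (B^~ v).
Proof. by move=> a u w; rewrite linearP. Qed.
Lemma flip_bound v u : `|B u v| <= `|B| * `|v| * `|u|.
Proof. by rewrite mulrAC norm_blin2. Qed.
Definition flipb : blin V (blin U W) :=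
  mkblin2 flip_linl flip_linr (normr_ge0 B) flip_bound.
End Flip.

Definition idb X : blin X X.
Proof.
by refine (@mkblin X X id 1 _ ler01 _) => // x; rewrite mul1r.
Defined.

Section Composition.
Variables (X Y Z : normedModType K).
Lemma comp_linear (u : blin Y Z) (w : blin X Y) : linear (u \o w).
Proof. by move=> a x y /=; rewrite !linearP. Qed.
Lemma comp_bound (u : blin Y Z) (w : blin X Y) x :
  `|(u \o w) x| <= (`|u| * `|w|) * `|x|.
Proof.
by rewrite (le_trans (norm_blin _ _))// -mulrA ler_wpM2l// norm_blin.
Qed.
Definition compb (u : blin Y Z) (w : blin X Y) : blin X Z :=
  mkblin (comp_linear u w) (mulr_ge0 (normr_ge0 u) (normr_ge0 w))
    (comp_bound u w).
Lemma compb_linl w : linear (compb^~ w).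
Proof. by move=> a u u'; apply/val_inj/funext. Qed.
Lemma compb_linr u : linear (compb u).
Proof. by move=> a w w'; apply/val_inj/funext => x; exact: linearP. Qed.
Lemma compb_bound u w : `|compb u w| <= 1 * `|u| * `|w|.
Proof.
by rewrite mul1r; apply: norm_blin_le; [rewrite mulr_ge0|exact: comp_bound].
Qed.
Definition compb2 : blin (blin Y Z) (blin (blin X Y) (blin X Z)) :=
  mkblin2 compb_linl compb_linr ler01 compb_bound.
End Composition.

(** * First derivatives as bounded operators *)

Section Differential.
Variables (X Y : normedModType K).
Implicit Types (f g : X -> Y) (L : blin X Y).

(** The epsilon form is what all estimates below use. *)
Lemma is_diffP f x L : is_diff x f L <->
  forall e : K, 0 < e -> \forall h \near 0, `|f (h + x) - f x - L h| <= e * `|h|.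
Proof.
split=> [[df dfE] e e0|fL].
  have /eqaddoP/(_ _ e0) := diff_locally df.
  apply: filterS => h /=; rewrite dfE.
  by rewrite -[X in `|X|]/(f (h + x) - (f x + L h)) opprD addrA.
have fE : f \o shift x = cst (f x) + L +o_ 0 id.
  apply/eqaddoP => e /fL; apply: filterS => h.
  by rewrite -[X in _ -> `|X| <= _]/(f (h + x) - (f x + L h)) opprD addrA.
have dfE := diff_unique (@blin_continuous _ _ _ L) fE.
by split => //; apply/diff_locallyP; rewrite dfE; split => //; exact: blin_continuous.
Qed.

(** The value of [dblin f] is by definition that of [nabla 1 f]. *)
Definition dblin f x : blin X Y := insubd (0 : blin X Y) ('d f x : X -> Y).

Lemma dblinE f x : differentiable f x -> dblin f x = 'd f x :> (X -> Y).
Proof.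
move=> df; rewrite /dblin -[LHS]/(\val _) insubdK// inE.
by split; [exact: linearP|exact: diff_continuous].
Qed.

Lemma is_diff_dblin f x : differentiable f x -> is_diff x f (dblin f x).
Proof. by move=> df; split=> //; rewrite dblinE. Qed.

Lemma dblin_val f x L : is_diff x f L -> dblin f x = L.
Proof. by case=> df dfE; apply/val_inj => /=; rewrite dblinE. Qed.

Lemma near_is_diff f g x L : (\forall y \near x, f y = g y) ->
  is_diff x f L -> is_diff x g L.
Proof.
move=> fg /is_diffP fL; apply/is_diffP => e e0.
have fgx : f x = g x by exact: nbhs_singleton fg.
have fg0 : \forall h \near 0, f (h + x) = g (h + x).
  by move: fg; rewrite (near_shift 0) subr0.
by near=> h; rewrite -fgx -(near fg0 h)//; near: h; exact: fL.
Unshelve. all: by end_near. Qed.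

Lemma near_dblin f g x : (\forall y \near x, f y = g y) -> differentiable f x ->
  dblin g x = dblin f x.
Proof. by move=> fg df; apply/dblin_val/(near_is_diff fg)/is_diff_dblin. Qed.

Lemma near_differentiable f g x : (\forall y \near x, f y = g y) ->
  differentiable f x -> differentiable g x.
Proof. by move=> fg /is_diff_dblin/(near_is_diff fg)[]. Qed.

Lemma is_diff_blin L x : is_diff x L L.
Proof.
by apply/is_diffP => e e0; near=> h; rewrite linearD addrK subrr normr0 mulr_ge0// ltW.
Unshelve. all: by end_near. Qed.

End Differential.

Section BilinearDiff.
Variables (X U V W : normedModType K) (B : blin U (blin V W)).

(** The derivative h |-> B (u' h) v + B u (v' h) of a product, written as the
    value of two bounded bilinear maps, one at (u', v) and one at (u, v').  A
    product is thus mapped by differentiation to a sum of products, which is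
    what makes an induction on the order of differentiability possible. *)
Definition bdiff (u : U) (v : V) (u' : blin X U) (v' : blin X V) : blin X W :=
  flipb (compb (compb2 X U W) (flipb B)) u' v + compb (compb2 X V W) B u v'.

(** Product rule: the error is B ru v(h+x) + B (u' h) (v(h+x) - v(x)) + B u(x) rv,
    where ru and rv are the errors of the factors, and each summand is o(h). *)
Lemma is_diff_bilinear (u : X -> U) (v : X -> V) x u' v' :
  is_diff x u (u' : blin X U) -> is_diff x v (v' : blin X V) ->
  is_diff x (fun y => B (u y) (v y)) (bdiff (u x) (v x) u' v').
Proof.
move=> du dv; have cv : {for x, continuous v}.
  by apply: differentiable_continuous; case: dv.
move/is_diffP: du => du; move/is_diffP: dv => dv; apply/is_diffP => e e0.
(* Where the errors of u and v are at most d * `|h| and the increment of v is at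
   most d and 1, the total error is at most (M - 1) * d * `|h|; the summand 1
   in M only makes it positive. *)
pose M := `|B| * (1 + `|v x| + `|u'| + `|u x|) + 1.
have M0 : 0 < M by rewrite ltr_wpDl// mulr_ge0// !addr_ge0.
pose d := e / M.
have d0 : 0 < d by rewrite divr_gt0.
have near0 P : (\forall y \near x, P y) -> \forall h \near 0, P (h + x).
  by rewrite (near_shift 0) subr0.
have vd : \forall h \near 0, `|v (h + x) - v x| <= d.
  apply: (near0 (fun y => `|v y - v x| <= d)).
  have /cvgr_dist_le/(_ _ d0) := cv.
  by apply: filterS => y; rewrite distrC.
have v1 : \forall h \near 0, `|v (h + x) - v x| <= 1.
  apply: (near0 (fun y => `|v y - v x| <= 1)).
  have /cvgr_dist_le/(_ _ ltr01) := cv.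
  by apply: filterS => y; rewrite distrC.
near=> h.
set ru := u (h + x) - u x - u' h; set rv := v (h + x) - v x - v' h.
have -> : B (u (h + x)) (v (h + x)) - B (u x) (v x) - bdiff (u x) (v x) u' v' h =
    B ru (v (h + x)) + B (u' h) (v (h + x) - v x) + B (u x) rv.
  have -> : bdiff (u x) (v x) u' v' h = B (u' h) (v x) + B (u x) (v' h) by [].
  (* p, q, w are B u(h+x) v(h+x), B u(x) v(h+x), B u(x) v(x), and r, t, z are
     B (u' h) v(h+x), B (u' h) v(x), B u(x) (v' h). *)
  have zmod_id (p q r t w z : W) :
      p - w - (t + z) = p - q - r + (r - t) + (q - w - z).
    rewrite subrKA [p - q - t]addrAC -[q - w - z]addrA subrKA addrA.
    by rewrite opprD addrA [p - w - t]addrAC.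
  by rewrite /ru /rv !linearB !blinBE; exact: zmod_id.
have ruh : `|ru| <= d * `|h| by rewrite /ru; near: h; exact: du.
have rvh : `|rv| <= d * `|h| by rewrite /rv; near: h; exact: dv.
have vh : `|v (h + x)| <= 1 + `|v x|.
  rewrite -[v (h + x)](subrK (v x)) (le_trans (ler_normD _ _))// lerD2r.
  by near: h.
have vhd : `|v (h + x) - v x| <= d by near: h.
have -> : e * `|h| = M * (d * `|h|).
  by rewrite mulrA [M * d]mulrC /d divfK// gt_eqF.
apply: (@le_trans _ _ (`|B| * (d * `|h|) * (1 + `|v x|) + `|B| * (`|u'| * `|h|) * d
    + `|B| * `|u x| * (d * `|h|))).
  rewrite (le_trans (ler_normD _ _))// lerD//.
    rewrite (le_trans (ler_normD _ _))// lerD//.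
      rewrite (le_trans (norm_blin2 _ _ _))// ler_pM ?mulr_ge0//.
      by rewrite ler_wpM2l.
    rewrite (le_trans (norm_blin2 _ _ _))// ler_pM ?mulr_ge0//.
    by rewrite ler_wpM2l// norm_blin.
  by rewrite (le_trans (norm_blin2 _ _ _))// ler_wpM2l// mulr_ge0.
have dh : 0 <= d * `|h| by rewrite mulr_ge0// ltW.
rewrite /M mulrDl mul1r.
rewrite (_ : `|B| * (d * `|h|) * (1 + `|v x|) + _ + _ =
  `|B| * (1 + `|v x| + `|u'| + `|u x|) * (d * `|h|)); first by rewrite lerDl.
by ring.
Unshelve. all: by end_near. Qed.
End BilinearDiff.
End BoundedOperators.

(** * Functions differentiable k times at a point *)

Section HigherDerivatives.
Context {R : realType} {s : scalars}.
Local Notation K := (scalar_field R s).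
Implicit Types X Y Z U V W : normedModType K.

Lemma nablaS k X Y (g : X -> Y) x : nabla k.+1 g x = dblin (nabla k g) x.
Proof. by []. Qed.

Lemma differentiable_n1 X Y (g : X -> Y) x :
  differentiable_n 1 g x <-> differentiable g x.
Proof. by split=> [[]//|dg]; split => //; exact: nearW. Qed.

Lemma differentiable_nS k X Y (g : X -> Y) x :
  differentiable_n k.+1 g x -> differentiable_n k g x.
Proof. by case=> /nbhs_singleton. Qed.

Lemma differentiable_n_le j k X Y (g : X -> Y) x : (j <= k)%N ->
  differentiable_n k g x -> differentiable_n j g x.
Proof.
move=> /subnK <-; elim: (k - j)%N => // i IH.
by rewrite addSn => /differentiable_nS.
Qed.

(** Higher derivatives depend only on the germ of the function.  Equality of the
    derivatives is claimed at the point alone; applied at the nearby points, it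
    gives the equality of germs that the next order needs. *)
Lemma near_differentiable_n k X Y (f g : X -> Y) x :
  (\forall y \near x, f y = g y) -> differentiable_n k f x ->
  differentiable_n k g x /\ nabla k g x = nabla k f x.
Proof.
elim: k x => [|k IH] x fg; first by move=> _; split=> //=; rewrite (nbhs_singleton fg).
case=> dnf df.
have nb : \forall y \near x, differentiable_n k g y /\ nabla k g y = nabla k f y.
  by near=> y; apply: IH; [near: y; exact: near_join|near: y].
have nfg : \forall y \near x, nabla k f y = nabla k g y.
  by apply: filterS nb => y [].
split; first by split; [apply: filterS nb => y []|exact: near_differentiable nfg df].
by rewrite !nablaS (near_dblin nfg df).
Unshelve. all: by end_near. Qed.

Lemma near_differentiable_nW k X Y (f g : X -> Y) x :
  (\forall y \near x, f y = g y) -> differentiable_n k f x ->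
  differentiable_n k g x.
Proof. by move=> fg /(near_differentiable_n fg)[]. Qed.

(** The spaces of maps [mlin k X (blin X Y)] and [mlin k.+1 X Y] are equal, but
    for a variable [k] not convertible: the innermost arrow of one is the base
    of the other. *)
Definition cast_normed V W (e : V = W) (u : V) : W := 
  let: erefl := e in u.

Lemma differentiable_cast X V W (e : V = W) (g : X -> V) x :
  differentiable (cast_normed e \o g) x <-> differentiable g x.
Proof. by case: W / e. Qed.

Lemma dblin_cast X V W (e : V = W) (g : X -> V) x :
  dblin (cast_normed e \o g) x =
  cast_normed (f_equal (fun Z => blin X Z : normedModType K) e) (dblin g x).
Proof. by case: W / e. Qed.

(** [nabla] takes the new derivative outermost; this identity exposes the
    innermost derivative instead.  It holds with no differentiability
    assumption, since both sides make the same default choices. *)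
Lemma nabla_peel k X Y (g : X -> Y) :
  exists e : mlin k X (blin X Y) = mlin k.+1 X Y,
    nabla k.+1 g = cast_normed e \o nabla k (dblin g).
Proof.
elim: k => [|k [e IH]]; first by exists erefl.
exists (f_equal (fun Z => blin X Z : normedModType K) e).
by apply/funext => x; rewrite nablaS IH dblin_cast.
Qed.

(** The inductive principle for proving closure properties: to be k+2 times
    differentiable at a point is to be differentiable nearby with a derivative
    that is k+1 times differentiable there. *)
Lemma differentiable_nSS k X Y (g : X -> Y) x :
  differentiable_n k.+2 g x <->
  (\forall y \near x, differentiable g y) /\ differentiable_n k.+1 (dblin g) x.
Proof.
elim: k x => [|k IH] x.
  split=> [[dg ddg]|[dg /differentiable_n1 ddg]]; split=> //.
  - by apply: filterS dg => y /differentiable_n1.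
  - exact/differentiable_n1.
  - by apply: filterS dg => y /differentiable_n1.
have [e eE] := nabla_peel k.+1 g.
split=> [[dg]|[dg [ddg dd]]].
  rewrite eE => /differentiable_cast dd; split; last split => //.
    by apply: filterS dg => y /IH[/nbhs_singleton].
  by apply: filterS dg => y /IH[].
split; last by rewrite eE; exact/differentiable_cast.
by near=> y; apply/IH; split; near: y => //; exact: near_join.
Unshelve. all: by end_near. Qed.

Lemma differentiable_nD k X Y (f g : X -> Y) x :
  differentiable_n k f x -> differentiable_n k g x ->
  differentiable_n k (fun y => f y + g y) x.
Proof.
elim: k X Y f g x => [//|[_ X Y f g x|k IH X Y f g x]].
  move=> /differentiable_n1 df /differentiable_n1 dg.
  exact/differentiable_n1/differentiableD.
move=> /differentiable_nSS[df ddf] /differentiable_nSS[dg ddg].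
apply/differentiable_nSS; split.
  by near=> y; apply: differentiableD; near: y.
apply: near_differentiable_nW (IH _ _ _ _ _ ddf ddg).
near=> y; apply/esym/dblin_val/is_diffD; apply: is_diff_dblin; near: y => //.
Unshelve. all: by end_near. Qed.

(** The spaces and the bilinear map vary in the induction, the derivative of a
    product being a sum of two products for other bilinear maps. *)
Lemma differentiable_n_bilinear k X U V W (B : blin U (blin V W))
    (u : X -> U) (v : X -> V) x :
  differentiable_n k u x -> differentiable_n k v x ->
  differentiable_n k (fun y => B (u y) (v y)) x.
Proof.
elim: k X U V W B u v x => [//|[_|k IH] X U V W B u v x].
  move=> /differentiable_n1 df /differentiable_n1 dg; apply/differentiable_n1.
  by have [] := is_diff_bilinear B (is_diff_dblin df) (is_diff_dblin dg).
move=> dnu dnv.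
have [du ddu] := (differentiable_nSS _ _ _).1 dnu.
have [dv ddv] := (differentiable_nSS _ _ _).1 dnv.
have dB : \forall y \near x, is_diff y (fun y => B (u y) (v y))
    (bdiff B (u y) (v y) (dblin u y) (dblin v y)).
  by near=> y; apply: is_diff_bilinear; apply: is_diff_dblin; near: y.
apply/differentiable_nSS; split; first by apply: filterS dB => y [].
apply: (near_differentiable_nW
  (f := fun y => bdiff B (u y) (v y) (dblin u y) (dblin v y))).
  by apply: filterS dB => y /dblin_val.
apply: differentiable_nD; apply: IH => //; exact: differentiable_nS.
Unshelve. all: by end_near. Qed.

(** The derivative of [g \o f] is the product of [dblin g \o f] and [dblin f]
    under composition of operators, so the previous lemma applies. *)
Lemma differentiable_n_comp k X Y Z (f : X -> Y) (g : Y -> Z) x :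
  differentiable_n k f x -> differentiable_n k g (f x) ->
  differentiable_n k (g \o f) x.
Proof.
elim: k X Y Z f g x => [//|[_|k IH] X Y Z f g x].
  move=> /differentiable_n1 df /differentiable_n1 dg.
  exact/differentiable_n1/differentiable_comp.
move=> dnf dng.
have [df ddf] := (differentiable_nSS _ _ _).1 dnf.
have [dg ddg] := (differentiable_nSS _ _ _).1 dng.
have cf : {for x, continuous f}.
  exact/differentiable_continuous/(nbhs_singleton df).
have dgf : \forall y \near x, differentiable g (f y) by exact: (cf _ dg).
have dc : \forall y \near x, is_diff y (g \o f)
    (compb2 X Y Z (dblin g (f y)) (dblin f y)).
  near=> y; apply: (@is_diff_comp _ _ _ _ _ (dblin f y) _ (dblin g (f y)));
  by apply: is_diff_dblin; near: y.
apply/differentiable_nSS; split; first by apply: filterS dc => y [].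
apply: (near_differentiable_nW
  (f := fun y => compb2 X Y Z (dblin g (f y)) (dblin f y))).
  by apply: filterS dc => y /dblin_val.
apply: differentiable_n_bilinear => //.
by apply: (IH _ _ _ f (dblin g)) => //; exact: differentiable_nS.
Unshelve. all: by end_near. Qed.

End HigherDerivatives.

(** * Mean value inequality and symmetry of the second derivative *)

Section MeanValue.
Context {R : realType} {s : scalars}.
Local Notation K := (scalar_field R s).
Implicit Types X Y Z U V W : normedModType K.

(** A pointwise Lipschitz bound along the segment [0, 1], whose points are the
    scalars [t] with [0 <= t <= 1] even in the complex case, is a global one:
    otherwise take the infimum m of the points t where
    `|phi t - phi 0| <= C * t fails.  The local bound on the left of m gives the
    inequality at m, and the local bound on its right then gives it on a whole
    interval after m. *)
Lemma local_lipschitz_segment Y (phi : K -> Y) (C : K) :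
  (forall t, 0 <= t <= 1 -> exists2 d : K, 0 < d &
     forall t', 0 <= t' <= 1 -> `|t' - t| < d ->
       `|phi t' - phi t| <= C * `|t' - t|) ->
  `|phi 1 - phi 0| <= C.
Proof.
move=> lip; apply: contrapT => nC.
pose A : set K := [set t | 0 <= t <= 1 /\ ~ (`|phi t - phi 0| <= C * t)].
have A1 : A 1 by split; [rewrite ler01 lexx|rewrite mulr1].
have [||m mlb mglb] := @scalar_inf_exists R s A; first by exists 1.
  by move=> t [/andP[]].
have m0 : 0 <= m by apply: mglb => t [/andP[]].
have m1 : m <= 1 by exact: mlb.
have [|d d0 dlip] := lip m; first by rewrite m0.
have mC : `|phi m - phi 0| <= C * m.
  move: m0; rewrite le_eqVlt => /predU1P[<-|m_gt0].
    by rewrite subrr normr0 mulr0.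
  (* a positive step below both m and d, which avoids a minimum in K *)
  pose e := m * d / (m + d).
  have md0 : 0 < m + d by rewrite addr_gt0.
  have e0 : 0 < e by rewrite divr_gt0// mulr_gt0.
  have em : e < m.
    by rewrite /e -mulrA gtr_pMr// ltr_pdivrMr// mul1r ltrDr.
  have ed : e < d.
    by rewrite /e mulrAC gtr_pMl// ltr_pdivrMr// mul1r ltrDl.
  have me01 : 0 <= m - e <= 1.
    by rewrite subr_ge0 (ltW em)/= (le_trans _ m1)// gerBl ltW.
  have : ~ A (m - e).
    by move=> /mlb; rewrite lerBrDl gerDr => /(lt_le_trans e0); rewrite ltxx.
  move=> /not_andP[//|/contrapT meC].
  rewrite -[phi m](subrK (phi (m - e))) -addrA (le_trans (ler_normD _ _))//.
  rewrite -[m in leRHS](subrK e) mulrDr [leRHS]addrC lerD// distrC.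
  have /= := dlip (m - e) me01.
  have -> : m - e - m = - e by rewrite addrAC subrr add0r.
  by rewrite normrN gtr0_norm//; exact.
have : lbound A (m + d).
  move=> t [t01 nt]; have [t0 t1] := andP t01.
  rewrite real_leNgt ?ger0_real ?addr_ge0 ?(ltW d0)//.
  apply/negP; rewrite -ltrBlDl => tmd; apply: (nt).
  have mt : 0 <= t - m by rewrite subr_ge0; apply: mlb; split.
  rewrite -[phi t](subrK (phi m)) -addrA (le_trans (ler_normD _ _))//.
  rewrite -[t in leRHS](subrK m) mulrDr lerD//.
  by rewrite -(ger0_norm mt) dlip// ger0_norm.
by move=> /mglb; rewrite gerDl => /(lt_le_trans d0); rewrite ltxx.
Qed.

(** Along the segment from [x] to [h + x] the map moves at speed at most C + e
    near each point, for every e > 0. *)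
Lemma mean_value X Y (f : X -> Y) (x h : X) (L : K -> blin X Y) (C : K) :
  0 <= C ->
  (forall t, 0 <= t <= 1 -> is_diff (t *: h + x) f (L t) /\ `|L t h| <= C) ->
  `|f (h + x) - f x| <= C.
Proof.
move=> C0 fL; apply/ler_addgt0Pr => e e0.
have h1 : 0 < 1 + `|h| by rewrite ltr_pwDl.
rewrite -{1}[h]scale1r -{2}[x]add0r -(scale0r h).
apply: (local_lipschitz_segment (phi := fun t => f (t *: h + x))).
move=> t /fL[/is_diffP ft LC].
have /nbhs_norm0P[d /= d0 fd] := ft _ (divr_gt0 e0 h1).
exists (d / (1 + `|h|)); first by rewrite divr_gt0.
move=> t' _; rewrite ltr_pdivlMr// => tt'.
have -> : t' *: h + x = (t' - t) *: h + (t *: h + x).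
  by rewrite addrA -scalerDl subrK.
have /fd : `|(t' - t) *: h| < d.
  rewrite normrZ (le_lt_trans _ tt')// ler_wpM2l// lerDr//.
rewrite linearZ normrZ /= => le1.
rewrite -[X in `|X|](subrK ((t' - t) *: L t h)) (le_trans (ler_normD _ _))//.
rewrite addrC mulrDl lerD//; first by rewrite normrZ mulrC ler_wpM2r.
rewrite (le_trans le1)// mulrCA mulrC ler_wpM2r// -mulrA.
apply: ler_piMr; first exact: ltW.
by rewrite ler_pdivrMl// mulr1 lerDr.
Qed.

Lemma is_diff_shift X Y (f : X -> Y) (x b : X) (L : blin X Y) :
  is_diff (x + b) f L -> is_diff x (fun z => f (z + b)) L.
Proof.
move=> /is_diffP fL; apply/is_diffP => e /fL; apply: filterS => h.
by rewrite addrA.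
Qed.

Section Schwarz.
Variables (X Y : normedModType K) (f : X -> Y) (x : X) (A : blin X (blin X Y)).
Variables (e r : K).
Hypothesis dfA : forall h, `|h| < r -> differentiable f (h + x) /\
  `|dblin f (h + x) - dblin f x - A h| <= e * `|h|.

(** The mean value inequality for z |-> f (z + b) - f z - A b z between x and
    x + a: its derivative is controlled by the expansion of [dblin f] at x. *)
Lemma second_difference (a b : X) : 0 <= e -> `|a| + `|b| < r ->
  `|f (a + (b + x)) - f (a + x) - (f (b + x) - f x) - A b a| <=
    (e * (`|a| + `|b|) + e * (`|a| + `|b|)) * (`|a| + `|b|).
Proof.
move=> e0 abr.
pose F z := f (z + b) - f z - A b z.
have -> : f (a + (b + x)) - f (a + x) - (f (b + x) - f x) - A b a = F (a + x) - F x.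
  rewrite /F (linearD (A b)) [a + x + b]addrAC -[a + b + x]addrA [x + b]addrC.
  have zmod_id (p q u v : Y) : p - q - u = p - (u + v) - (q - v).
    by rewrite opprB opprD [p + (_ - _)]addrA subrKA addrAC.
  exact: zmod_id.
have ab0 : 0 <= `|a| + `|b| by rewrite addr_ge0.
apply: (@mean_value _ _ _ _ _
  (fun t => dblin f (t *: a + b + x) - dblin f (t *: a + x) - A b)).
  by rewrite mulr_ge0// addr_ge0// mulr_ge0.
move=> t /andP[t0 t1].
have ta : `|t *: a| <= `|a| by rewrite normrZ (ger0_norm t0) ler_piMl.
have [|dta ta_e] := dfA (h := t *: a).
  by rewrite (le_lt_trans ta)// (le_lt_trans _ abr)// lerDl.
have tab : `|t *: a + b| <= `|a| + `|b|.
  by rewrite (le_trans (ler_normD _ _))// lerD2r.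
have [|dtab tab_e] := dfA (h := t *: a + b).
  exact: le_lt_trans abr.
split.
  apply: is_diffB; last exact: is_diff_blin.
  apply: is_diffB; last exact: is_diff_dblin.
  rewrite addrAC; apply: is_diff_shift; apply: is_diff_dblin.
  by rewrite addrAC.
rewrite (le_trans (norm_blin _ _))//; apply: ler_pM => //; last by rewrite lerDl.
set p := dblin f (t *: a + b + x); set q := dblin f (t *: a + x).
have -> : p - q - A b =
    (p - dblin f x - A (t *: a + b)) - (q - dblin f x - A (t *: a)).
  have zmod_id (k u v : blin X Y) : p - q - v = p - k - (u + v) - (q - k - u).
    rewrite [- (q - k - u)]opprD opprB opprK addrACA subrKA opprD.
    by rewrite [- u - v + u]addrAC addNr add0r.
  by rewrite (linearD A); exact: zmod_id.
rewrite (le_trans (ler_normB _ _))// lerD//.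
  by rewrite (le_trans tab_e)// ler_wpM2l.
by rewrite (le_trans ta_e)// ler_wpM2l// (le_trans ta)// lerDl.
Qed.
End Schwarz.

Lemma schwarz_scaling (F : fieldType) (e n t c : F) : n != 0 ->
  let d := e / (4 * n ^+ 2) in let S := t * c in 4 != 0 :> F ->
  (d * S + d * S) * S + (d * S + d * S) * S = t ^+ 2 * (e * (c / n) ^+ 2).
Proof. by move=> n0 d S F4; rewrite /d /S; field; rewrite n0. Qed.

(** Schwarz's theorem: the second difference of [f] along [t *: a], [t *: b] is
    symmetric and is both t^2 A b a + o(t^2) and t^2 A a b + o(t^2). *)
Lemma symmetric_second_derivative X Y (f : X -> Y) x :
  differentiable_n 2 f x -> forall a b,
  nabla 2 f x a b = nabla 2 f x b a.
Proof.
move=> /differentiable_nSS[df /differentiable_n1/is_diff_dblin ddf] a b.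
rewrite -[nabla 2 f x]/(dblin (dblin f) x); move: ddf; set A := dblin _ _ => ddf.
pose N := `|a| + `|b| + 1.
have N0 : 0 < N by rewrite ltr_wpDl// addr_ge0.
apply/eqP; rewrite -subr_eq0 -normr_le0; apply/ler_addgt0Pr => e e0; rewrite add0r.
(* Two second differences, each with two error terms d * S * S where
   S <= t * N, will add up to at most t ^+ 2 * e. *)
pose d := e / (4 * N ^+ 2).
have d0 : 0 < d by rewrite divr_gt0// mulr_gt0// exprn_gt0.
have : \forall h \near 0, differentiable f (h + x) /\
    `|dblin f (h + x) - dblin f x - A h| <= d * `|h|.
  near=> h; split; near: h; last by move/is_diffP: ddf; apply.
  by move: df; rewrite (near_shift 0) subr0.
move=> /nbhs_norm0P[r /= r0 fr].
pose t := r / N; have t0 : 0 < t by rewrite divr_gt0.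
have tab : `|t *: a| + `|t *: b| < r.
  rewrite (normrZ t a) (normrZ t b) -mulrDr gtr0_norm// /t -mulrA.
  rewrite gtr_pMr// ltr_pdivrMl// mulr1.
  by rewrite ltrDl.
have ab := second_difference fr (ltW d0) tab.
have := second_difference fr (ltW d0) (a := t *: b) (b := t *: a).
rewrite [`|t *: b| + _]addrC => /(_ tab) ba.
have := lerD ab ba; move/(le_trans (ler_normB _ _)).
rewrite [t *: b + (t *: a + x)]addrCA.
set S := `|t *: a| + `|t *: b| in ab ba *.
set P := f _; set Q := f _; set Q' := f _; set P' := f x.
have -> : P - Q - (Q' - P') - A (t *: b) (t *: a) -
   (P - Q' - (Q - P') - A (t *: a) (t *: b)) = t ^+ 2 *: (A a b - A b a).
  have -> : P - Q' - (Q - P') = P - Q - (Q' - P').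
    by rewrite !opprB addrACA [RHS]addrACA [- Q' + _]addrC.
  move: (P - Q - (Q' - P')) => D; rewrite opprB [LHS]addrC subrKA.
  have AE u v : A (t *: u) (t *: v) = t ^+ 2 *: A u v.
    by rewrite (blin_scale A) blinZE blin_scale scalerA.
  by rewrite !AE -scalerBr.
rewrite normrZ ger0_norm ?exprn_ge0// ?(ltW t0)// => abt.
rewrite -(ler_pM2l (exprn_gt0 2 t0)) (le_trans abt)//.
have SE : S = t * (`|a| + `|b|).
  by rewrite /S (normrZ t a) (normrZ t b) gtr0_norm// mulrDr.
have -> : (d * S + d * S) * S + (d * S + d * S) * S =
    t ^+ 2 * (e * ((`|a| + `|b|) / N) ^+ 2).
  by rewrite SE; apply: schwarz_scaling; rewrite ?pnatr_eq0// gt_eqF.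
rewrite ler_wpM2l ?exprn_ge0 ?(ltW t0)// ler_piMr ?(ltW e0)//.
rewrite exprn_ile1 ?divr_ge0 ?addr_ge0 ?(ltW N0)//.
by rewrite ler_pdivrMr// mul1r lerDl.
Unshelve. all: by end_near. Qed.
End MeanValue.

(** * Multilinear maps on sequences of vectors, symmetry of derivatives *)

Section MultilinearOnSequences.
Context {R : realType} {s : scalars}.
Local Notation K := (scalar_field R s).
Implicit Types X Y Z U V W : normedModType K.

(** Listing the arguments in a sequence lets permutations and insertions of
    arguments be expressed by [perm_eq] and [::].  Missing arguments are read as
    0, and the values of interest have [size r = k]. *)
Fixpoint mlin_seq k X Y : mlin k X Y -> seq X -> Y :=
  match k return mlin k X Y -> seq X -> Y with
  | 0 => fun u _ => u
  | k'.+1 => fun u r => mlin_seq (u (head 0 r)) (behead r)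
  end.

Lemma mlin_seq_cons k X Y (u : mlin k.+1 X Y) a r :
  mlin_seq u (a :: r) = mlin_seq (u a) r.
Proof. by []. Qed.

Lemma mlin_app_codom k X Y (u : mlin k X Y) (v : 'I_k -> X) :
  mlin_app u v = mlin_seq u (codom v).
Proof.
elim: k u v => [//|k IH] u v.
by rewrite codomE enum_ordSl map_cons mlin_seq_cons /= IH codomE -map_comp.
Qed.

Lemma codom_enum_val (T : finType) (A : {set T}) :
  codom (@enum_val _ (mem A)) = enum A.
Proof.
rewrite codomE; case: (pickP (mem A)) => [x0 _|A0].
  apply: (@eq_from_nth _ x0); rewrite size_map size_enum_ord ?cardE// => i iA.
  rewrite (nth_map (Ordinal iA)) ?size_enum_ord// (enum_val_nth x0).
  by rewrite nth_enum_ord.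
have A_0 := eq_card0 A0.
have -> : enum A = [::] by apply: size0nil; rewrite -cardE; exact: A_0.
by apply: size0nil; rewrite size_map size_enum_ord; exact: A_0.
Qed.

Lemma mlin_app_enum_val (T : finType) (A : {set T}) X Y
    (u : mlin #|A| X Y) (w : T -> X) :
  mlin_app u (fun i => w (enum_val i)) = mlin_seq u [seq w i | i <- enum A].
Proof. by rewrite mlin_app_codom -codom_enum_val !codomE -map_comp. Qed.

Lemma mlin_seqD k X Y (u w : mlin k X Y) r :
  mlin_seq (u + w) r = mlin_seq u r + mlin_seq w r.
Proof. by elim: k u w r => [//|k IH] u w r; exact: IH. Qed.

Definition mlin_sym k X Y (u : mlin k X Y) := forall r t : seq X,
  size r = k -> perm_eq r t -> mlin_seq u r = mlin_seq u t.

(** Invariance under permutations of all arguments but the first, together with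
    the exchange of the first two, gives full symmetry: to move b to the front
    of a :: r, bring it to the second place and exchange. *)
Lemma mlin_symSS k X Y (u : mlin k.+2 X Y) :
  (forall a, @mlin_sym k.+1 X Y (u a)) -> (forall a b, u a b = u b a) -> mlin_sym u.
Proof.
move=> usym uswap [//|a r] [|b t] [sr] rt; first by have := perm_size rt.
rewrite !mlin_seq_cons; have [ab|ab] := eqVneq a b.
  by rewrite -ab; apply: usym => //; move: rt; rewrite -ab perm_cons.
have br : b \in r.
  by have := perm_mem rt b; rewrite !inE eqxx eq_sym (negPf ab).
have rE := perm_to_rem br.
have tE : perm_eq (a :: rem b r) t.
  rewrite -(perm_cons b) -(permPr rt).
  have /permPl -> : perm_eq [:: b, a & rem b r] ([:: a; b] ++ rem b r).
    by rewrite (perm_catCA [:: b] [:: a]).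
  by rewrite perm_cons perm_sym.
rewrite (usym _ _ _ sr rE) mlin_seq_cons uswap -mlin_seq_cons.
by rewrite (usym _ _ _ _ tE)//= size_rem// sr.
Qed.

Lemma dblin_eval X U V (G : X -> blin U V) (g : X -> U) x :
  differentiable G x -> differentiable g x ->
  differentiable (fun y => G y (g y)) x /\
  forall b, dblin (fun y => G y (g y)) x b =
    dblin G x b (g x) + G x (dblin g x b).
Proof.
move=> /is_diff_dblin dG /is_diff_dblin dg.
have dGg := is_diff_bilinear (idb (blin U V)) dG dg.
by split=> [|b]; [case: dGg|rewrite (dblin_val dGg)].
Qed.

Lemma dblin_mlin_seq k X U V (G : X -> mlin k U V) (r : seq U) x :
  differentiable G x ->
  differentiable (fun y => mlin_seq (G y) r) x /\
  forall b, dblin (fun y => mlin_seq (G y) r) x b = mlin_seq (dblin G x b) r.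
Proof.
elim: k G r => [|k IH] G r dG; first by split.
have dr : differentiable (cst (head 0 r) : X -> U) x by exact: differentiable_cst.
have [dGr dGrE] := dblin_eval dG dr.
have [d1 d1E] := IH _ (behead r) dGr; split=> // b.
rewrite d1E dGrE.
have -> : dblin (cst (head 0 r) : X -> U) x = 0.
  by apply: dblin_val; exact: is_diff_cst.
by rewrite [X in _ + X](linear0 (G x)) addr0.
Qed.

(** Product rule for a multilinear map and arguments that all vary.  The
    sequence is duplicate-free so that the summand of [j] changes one argument
    only. *)
Lemma dblin_mlin_map k X U V (I : eqType) (r : seq I) (G : X -> mlin k U V)
    (h : I -> X -> U) x :
  size r = k -> uniq r -> differentiable G x ->
  (forall i, i \in r -> differentiable (h i) x) ->
  differentiable (fun y => mlin_seq (G y) [seq h i y | i <- r]) x /\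
  forall b, dblin (fun y => mlin_seq (G y) [seq h i y | i <- r]) x b =
    mlin_seq (dblin G x b) [seq h i x | i <- r] +
    \sum_(j <- r) mlin_seq (G x)
      [seq if i == j then dblin (h i) x b else h i x | i <- r].
Proof.
elim: k r G => [|k IH] [|j r]//= G.
  by move=> _ _ dG _; split=> // b; rewrite big_nil addr0.
move=> [sr] /andP[jr ur] dG dh.
have [dGj dGjE] := dblin_eval dG (dh j (mem_head _ _)).
have [|d1 d1E] := IH r _ sr ur dGj.
  by move=> i ir; apply: dh; rewrite inE ir orbT.
split=> // b; rewrite d1E dGjE mlin_seqD -addrA; congr (_ + _).
rewrite big_cons eqxx; congr (_ + _).
  congr mlin_seq; apply/eq_in_map => i ir.
  by rewrite (negPf (memPn jr _ ir)).
apply: eq_big_seq => i ir /=.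
by rewrite eq_sym (negPf (memPn jr _ ir)).
Qed.

(** The derivative of a function with symmetric values has symmetric values,
    which takes care of all arguments but the first; the first two are exchanged
    by Schwarz's theorem applied to [nabla k g]. *)
Lemma nabla_sym k X Y (g : X -> Y) x :
  differentiable_n k g x -> mlin_sym (nabla k g x).
Proof.
elim: k x => [|k IH] x; first by move=> _ r t.
move=> [dn dg].
have symS a : @mlin_sym k X Y (nabla k.+1 g x a).
  move=> r t sr rt; rewrite nablaS.
  have [dr drE] := dblin_mlin_seq r dg.
  have [_ dtE] := dblin_mlin_seq t dg.
  apply: etrans (esym (drE a)) (etrans _ (dtE a)).
  suff E : dblin (fun y => mlin_seq (nabla k g y) r) x =
      dblin (fun y => mlin_seq (nabla k g y) t) x.
    exact: (f_equal (fun L : blin X Y => L a) E).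
  apply/esym/near_dblin => //.
  by near=> y; apply: IH => //; near: y.
case: k symS IH dn dg => [|k] symS IH dn dg.
  by move=> r t sr rt; rewrite (perm_small_eq _ rt)// -(perm_size rt) sr.
apply: mlin_symSS => // a b; apply: symmetric_second_derivative; split=> //.
by apply: filterS dn => y [_]; split => //; exact: nearW.
Unshelve. all: by end_near. Qed.

Definition multi_deriv X Y (g : X -> Y) x (r : seq X) : Y :=
  mlin_seq (nabla (size r) g x) r.

Lemma multi_derivE k X Y (g : X -> Y) x (r : seq X) : size r = k ->
  mlin_seq (nabla k g x) r = multi_deriv g x r.
Proof. by move=> <-. Qed.

Lemma perm_multi_deriv X Y (g : X -> Y) x (r t : seq X) :
  differentiable_n (size r) g x -> perm_eq r t ->
  multi_deriv g x r = multi_deriv g x t.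
Proof.
move=> dg rt; rewrite /multi_deriv (perm_size rt); apply: nabla_sym => //.
- by rewrite -(perm_size rt).
- exact: perm_size.
Qed.

Lemma multi_deriv_cons X Y (g : X -> Y) x a (r : seq X) :
  differentiable_n (size r).+1 g x ->
  differentiable (fun y => multi_deriv g y r) x /\
  multi_deriv g x (a :: r) = dblin (fun y => multi_deriv g y r) x a.
Proof.
by move=> [_ dg]; have [d dE] := dblin_mlin_seq r dg; split=> //; rewrite dE.
Qed.

End MultilinearOnSequences.

(** * Faa di Bruno's formula for two maps *)

Lemma perm_enum_setU1 (T : finType) (a : T) (A : {set T}) :
  a \notin A -> perm_eq (enum (a |: A)%SET) (a :: enum A).
Proof.
move=> aA; apply: uniq_perm; rewrite ?enum_uniq//=.
  by rewrite mem_enum aA enum_uniq.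
by move=> z; rewrite inE !mem_enum !inE.
Qed.

Lemma card_partition_le (T : finType) (D : {set {set T}}) (C : {set T}) :
  finset.partition D C -> (#|D| <= #|C|)%N.
Proof.
move=> pD; rewrite (card_partition pD) -sum1_card leq_sum// => B BD.
by rewrite card_gt0 (partition_neq0 pD).
Qed.

Section FaaDiBruno.
Context {R : realType} {s : scalars}.
Local Notation K := (scalar_field R s).
Variables (X Y Z : normedModType K) (f : X -> Y) (g : Y -> Z).
Variables (T : finType) (w : T -> X).

Definition block_deriv (x : X) (Q : {set T}) : Y :=
  multi_deriv f x [seq w i | i <- enum Q].

Definition partition_term (x : X) (D : {set {set T}}) : Z :=
  multi_deriv g (f x) [seq block_deriv x Q | Q <- enum D].

Lemma size_block (Q : {set T}) : size [seq w i | i <- enum Q] = #|Q|.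
Proof. by rewrite size_map -cardE. Qed.

Lemma block_deriv_insert x a (Q : {set T}) :
  a \notin Q -> differentiable_n #|Q|.+1 f x ->
  differentiable (fun y => block_deriv y Q) x /\
  dblin (fun y => block_deriv y Q) x (w a) = block_deriv x (a |: Q)%SET.
Proof.
move=> aQ; rewrite -size_block => df.
have [d dE] := multi_deriv_cons (w a) df; split=> //.
rewrite -dE /block_deriv -map_cons; apply/esym/perm_multi_deriv.
  by rewrite size_map -cardE cardsU1 aQ -size_block.
exact/perm_map/perm_enum_setU1.
Qed.

(** Differentiating the term of [D] along the new direction: the derivative
    falling on [g] creates the block [[set a]] by the chain rule, and the one
    falling on the factor of a block [Q] adds [a] to [Q].  Symmetry lets the new
    argument, which comes first, be moved to its place in the enumeration. *)
Lemma partition_term_deriv (C : {set T}) (D : {set {set T}}) x a :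
  a \notin C -> finset.partition D C ->
  differentiable_n #|C|.+1 f x -> differentiable_n #|C|.+1 g (f x) ->
  differentiable (fun y => partition_term y D) x /\
  dblin (fun y => partition_term y D) x (w a) =
    partition_term x ([set a] |: D)%SET +
    \sum_(Q in D) partition_term x ((a |: Q) |: D :\ Q)%SET.
Proof.
move=> aC pD df dg.
have DC := card_partition_le pD.
have QC Q : Q \in D -> (#|Q| <= #|C|)%N by move=> /(partitionS pD)/subset_leq_card.
have aQ Q : Q \in D -> a \notin Q by apply: contraL; exact: notin_block pD.
have [_ dng] : differentiable_n #|D|.+1 g (f x) by exact: differentiable_n_le dg.
have df1 : differentiable f x by apply/differentiable_n1; exact: differentiable_n_le df.
have dQ Q : Q \in D -> differentiable (fun y => block_deriv y Q) x.
  move=> QD; apply: (block_deriv_insert (aQ _ QD) _).1.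
  by apply: differentiable_n_le df; rewrite ltnS QC.
have termE y : partition_term y D =
    mlin_seq (nabla #|D| g (f y)) [seq block_deriv y Q | Q <- enum D].
  by rewrite multi_derivE// size_map -cardE.
have dG : is_diff x (fun y => nabla #|D| g (f y))
    (compb2 X Y _ (dblin (nabla #|D| g) (f x)) (dblin f x)).
  by apply: (@is_diff_comp _ _ _ _ f (dblin f x) (nabla #|D| g)
    (dblin (nabla #|D| g) (f x))); exact: is_diff_dblin.
have [||||d dE] := @dblin_mlin_map _ _ #|D| X Y Z _ (enum D)
  (fun y => nabla #|D| g (f y)) (fun Q y => block_deriv y Q) x.
- by rewrite -cardE.
- exact: enum_uniq.
- by case: dG.
- by move=> Q; rewrite mem_enum; exact: dQ.
have -> : (fun y => partition_term y D) = fun y =>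
    mlin_seq (nabla #|D| g (f y)) [seq block_deriv y Q | Q <- enum D].
  exact/funext.
split=> //; rewrite dE (dblin_val dG); congr (_ + _).
  rewrite -[compb2 _ _ _ _ _ _]/(nabla #|D|.+1 g (f x) (dblin f x (w a))).
  rewrite -mlin_seq_cons multi_derivE ?size_map/= ?size_map -?cardE//.
  have -> : dblin f x (w a) = block_deriv x [set a]%SET.
    by rewrite /block_deriv finset.enum_set1.
  rewrite -(map_cons (block_deriv x)); apply/esym/perm_multi_deriv.
    rewrite size_map -cardE; apply: differentiable_n_le dg.
    have := card_partition_le (partition_add_singleton aC pD).
    by rewrite (cardsU1 a C) aC.
  by apply/perm_map/perm_enum_setU1/(notin_block aC pD); rewrite inE.
rewrite big_enum; apply: eq_bigr => Q QD.
rewrite multi_derivE ?size_map -?cardE//.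
have QDQ : Q \notin (D :\ Q)%SET by rewrite !inE eqxx.
have := perm_enum_setU1 QDQ; rewrite finset.setD1K// => permD.
rewrite (perm_multi_deriv _ (perm_map _ permD)); last first.
  by rewrite size_map -cardE; apply: differentiable_n_le dg; rewrite (leq_trans DC).
have dfQ : differentiable_n #|Q|.+1 f x.
  by apply: differentiable_n_le df; rewrite ltnS QC.
have [_ insertE] := block_deriv_insert (aQ _ QD) dfQ.
rewrite map_cons (eqxx Q).
rewrite (_ : map _ _ = [seq block_deriv x i | i <- enum (D :\ Q)%SET]); last first.
  by apply/eq_in_map => i; rewrite mem_enum !inE => /andP[/negPf ->].
rewrite insertE.
rewrite -(map_cons (block_deriv x)); apply/esym/perm_multi_deriv.
  rewrite size_map -cardE; apply: differentiable_n_le dg.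
  have := card_partition_le (partition_add_in_block aC pD QD).
  by rewrite (cardsU1 a C) aC.
apply/perm_map/perm_enum_setU1; rewrite !inE negb_and.
by rewrite (notin_block aC pD) ?orbT// setU11.
Qed.

End FaaDiBruno.

Section FaaDiBrunoFormula.
Context {R : realType} {s : scalars}.
Local Notation K := (scalar_field R s).
Implicit Types X Y Z : normedModType K.

Lemma dblin_sum X Y (I : Type) (r : seq I) (P : pred I) (F : I -> X -> Y) x :
  (forall i, P i -> differentiable (F i) x) ->
  differentiable (fun y => \sum_(i <- r | P i) F i y) x /\
  forall b, dblin (fun y => \sum_(i <- r | P i) F i y) x b =
    \sum_(i <- r | P i) dblin (F i) x b.
Proof.
move=> dF; elim: r => [|i r [dr drE]].
  rewrite (_ : (fun y => _) = cst 0); last by apply/funext => y; rewrite big_nil.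
  split; first exact: differentiable_cst.
  move=> b; rewrite big_nil.
  by rewrite (dblin_val (L := 0) (is_diff_cst (0 : Y) x)).
under eq_fun do rewrite big_cons.
case Pi: (P i); last by split=> // b; rewrite big_cons Pi.
have di := is_diffD (is_diff_dblin (dF i Pi)) (is_diff_dblin dr).
split=> [|b]; first by case: di.
by rewrite big_cons Pi -drE (dblin_val (L := dblin (F i) x + dblin _ x) di).
Qed.

(** By induction on the directions: the formula holds near x for [r], hence both
    sides have the same derivative along the additional direction. *)
Theorem faa_di_bruno X Y Z (f : X -> Y) (g : Y -> Z) (T : finType) (w : T -> X)
    (r : seq T) x :
  uniq r -> differentiable_n (size r) f x -> differentiable_n (size r) g (f x) ->
  multi_deriv (g \o f) x [seq w i | i <- r] =
  \sum_(D | finset.partition D [set i in r]%SET) partition_term f g w x D.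
Proof.
elim: r x => [|a r IH] x.
  move=> _ _ _; rewrite finset.set_nil.
  under eq_bigl do rewrite finset.partition_set0.
  by rewrite big_pred1_eq /partition_term finset.enum_set0.
rewrite cons_uniq => /andP[ar ur].
rewrite -[size (a :: r)]/(size r).+1 => df dg.
have dgf := differentiable_n_comp df dg.
have [dgf1 dgf1E] :
    differentiable (fun y => multi_deriv (g \o f) y [seq w i | i <- r]) x /\
    multi_deriv (g \o f) x (w a :: [seq w i | i <- r]) =
    dblin (fun y => multi_deriv (g \o f) y [seq w i | i <- r]) x (w a).
  by apply: multi_deriv_cons; rewrite size_map.
set C := [set i in r]%SET.
have aC : a \notin C by rewrite inE.
have Cr : #|C| = size r by rewrite cardsE; exact/card_uniqP.
have term D : finset.partition D C ->
  differentiable (fun y => partition_term f g w y D) x /\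
  dblin (fun y => partition_term f g w y D) x (w a) =
    partition_term f g w x ([set a] |: D)%SET +
    \sum_(Q in D) partition_term f g w x ((a |: Q) |: D :\ Q)%SET.
  by move=> pD; apply: partition_term_deriv pD _ _ => //; rewrite Cr.
have IHx : \forall y \near x, multi_deriv (g \o f) y [seq w i | i <- r] =
    \sum_(D | finset.partition D C) partition_term f g w y D.
  have [df' _] := df; have [dg' _] := dg.
  have cf : {for x, continuous f}.
    by apply/differentiable_continuous/differentiable_n1; exact: differentiable_n_le df.
  near=> y; apply: IH => //; near: y => //.
  exact: (cf _ dg').
rewrite dgf1E -(near_dblin IHx dgf1).
have [_ ->] := dblin_sum (index_enum _) (fun D pD => (term D pD).1).
rewrite finset.set_cons sum_partitionU1//; apply: eq_bigr => D pD.
exact: (term D pD).2.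
Unshelve. all: by end_near. Qed.

(** * Chains of maps *)

Lemma card_nested_partitions (T : finType) (A : {set T}) j
    (C : {set nested_set T j}) : C \in nested_partitions A j -> (#|C| <= #|A|)%N.
Proof.
elim: j C => [|j IH] C /=; first by rewrite inE => /eqP ->.
move=> /bigcupP[C' C'A]; rewrite inE => pC.
exact: leq_trans (card_partition_le pC) (IH _ C'A).
Qed.

(** The outer map [g] is arbitrary so that the induction can absorb the last map
    of the chain into it: g o (f_j o chain j) = (g o f_j) o chain j.  The case
    g = f_l is the theorem. *)
Theorem nabla_chain (X : nat -> normedModType K) (f : forall i, X i -> X i.+1)
    (x : X 0%N) m (T : finType) (v : T -> X 0%N) j Y (g : X j -> Y) :
  #|T| = m ->
  (forall i, (i < j)%N -> differentiable_n m (f i) (chain f i x)) ->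
  differentiable_n m g (chain f j x) ->
  differentiable_n m (g \o chain f j) x /\
  mlin_seq (nabla m (g \o chain f j) x) [seq v i | i <- enum [set: T]%SET] =
  \sum_(C in nested_partitions [set: T]%SET j)
    multi_deriv g (chain f j x) [seq nabla_nested f x v (j := j) P | P <- enum C].
Proof.
move=> Tm; have szT : size [seq v i | i <- enum [set: T]%SET] = m.
  by rewrite size_map -cardE cardsT.
elim: j Y g => [|j IH] Y g df dg.
  split=> //; rewrite /= big_set1.
  by rewrite multi_derivE.
have dfj := df j (ltnSn j).
have [|//|dgf ->] := IH _ (g \o f j).
- by move=> i ij; apply: df; exact: ltnW.
- exact: differentiable_n_comp.
split=> //=.
(* The sets of partitions of distinct C are disjoint: C is recovered as the
   cover of the partition. *)
rewrite (partition_big (@finset.cover (nested_set T j))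
  (fun C => C \in nested_partitions [set: T]%SET j)) /=; last first.
  by move=> D /bigcupP[C CA]; rewrite inE => /cover_partition ->.
apply: eq_bigr => C CA.
have Cm : (size (enum C) <= m)%N.
  by rewrite -cardE -Tm -cardsT; exact: card_nested_partitions CA.
rewrite faa_di_bruno ?enum_uniq//; last 2 first.
- exact: differentiable_n_le dfj.
- exact: differentiable_n_le dg.
rewrite finset.set_enum; apply: eq_big => [D|D pD].
  apply/idP/andP => [pD|[/bigcupP[C' _]]].
    split; last by rewrite (cover_partition pD).
    by apply/bigcupP; exists C; rewrite ?inE.
  by rewrite inE => pD /eqP <-; rewrite (cover_partition pD).
congr multi_deriv; apply/eq_map => Q /=.
by rewrite mlin_app_enum_val multi_derivE// size_map -cardE.
Qed.
End FaaDiBrunoFormula.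

Theorem proposition4p1 (R : realType) (s : scalars) (l m : nat)
    (X : nat -> completeNormedModType (scalar_field R s))
    (Omega : forall i, set (X i)) (f : forall i, X i -> X i.+1) (x : X 0%N) :
  (1 <= l)%N -> (1 <= m)%N ->
  (forall i, (i <= l.+1)%N -> open (Omega i)) ->
  (forall i, (i <= l)%N -> forall y, Omega i y -> Omega i.+1 (f i y)) ->
  Omega 0%N x ->
  (forall i, (i <= l)%N -> differentiable_n m (f i) (chain f i x)) ->
  differentiable_n m (chain f l.+1) x /\
  forall v : 'I_m -> X 0%N,
    mlin_app (nabla m (chain f l.+1) x) v =
    \sum_(P in nested_partitions [set: 'I_m] l) nabla_nested f x v (j := l.+1) P.
Proof.
move=> _ _ _ _ _ df.
have main v := @nabla_chain R s X f x m 'I_m v l (X l.+1) (f l) (card_ord m)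
  (fun i il => df i (ltnW il)) (df l (leqnn l)).
split=> [|v]; first by have [] := main (fun=> 0).
rewrite mlin_app_codom codomE enumT -finset.enum_setT (main v).2.
apply: eq_bigr => C _ /=.
by rewrite mlin_app_enum_val multi_derivE// size_map -cardE.
Qed.
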